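(* Assume (H1), (H7) and (H8) hold, and let $\gamma>0$ satisfy $K_6e^{\gamma\tau}+\gamma\le\bar K_6$ and $K_7e^{\gamma\tau}\le\bar K_7$, with the constants of (H7). Then for every $\varepsilon\in(0,\gamma)$ there are $\bar\triangle\in(0,1]$ and a constant $C>0$ independent of $i$ and $\triangle$ such that for every stepsize $\triangle=\tau/N\in(0,\bar\triangle]$ ($N$ a positive integer) the scheme $(y_i^{\triangle})$ satisfies $$\mathbb{E}|y_i^{\triangle}|^2\le Ce^{-(\gamma-\varepsilon)t_i}\qquad\text{for all } i\ge0,\quad t_i=i\triangle.$$
   Context: Setting. $|\cdot|$ is the Euclidean norm on $\mathbb{R}^d$ and the Hilbert–Schmidt norm on $\mathbb{R}^{d\times m}$; $a\vee b=\max(a,b)$, $a\wedge b=\min(a,b)$; $\mathbb{R}_+=[0,\infty)$. Let $\tau>0$, let $f:\mathbb{R}^d\times\mathbb{R}^d\to\mathbb{R}^d$ and $g:\mathbb{R}^d\times\mathbb{R}^d\to\mathbb{R}^{d\times m}$ be Borel measurable with $f(\mathbf 0,\mathbf 0)=0$, $g(\mathbf 0,\mathbf 0)=0$ (standing assumption), and let $W$ be an $m$-dimensional Brownian motion on a complete filtered probability space $(\Omega,\mathcal{F},(\mathcal{F}_t),\mathbb{P})$ satisfying the usual conditions. Let $\xi\in\mathcal{C}([-\tau,0];\mathbb{R}^d)$ be a deterministic continuous function, $\|\xi\|=\sup_{-\tau\le\theta\le0}|\xi(\theta)|$. The underlying stochastic delay differential equation is $dx(t)=f(x(t),x(t-\tau))\,dt+g(x(t),x(t-\tau))\,dW(t)$,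 $t>0$, with $x(t)=\xi(t)$ on $[-\tau,0]$. (H1) For every $l_1>0$ there is $L_{l_1}>0$ such that $|f(x,y)-f(\bar x,y)|\vee|g(x,y)-g(\bar x,y)|\le L_{l_1}|x-\bar x|$ for all $x,\bar x,y\in\mathbb{R}^d$ with $|x|\vee|\bar x|\vee|y|\le l_1$. (H7) There are constants $\bar K_6>K_6>0$, $\bar K_7>K_7\ge0$ and a continuous function $V_2:\mathbb{R}^d\to\mathbb{R}_+$ such that for all $x,y\in\mathbb{R}^d$, $$\langle2x,f(x,y)\rangle+|g(x,y)|^2\le-\bar K_6|x|^2+K_6|y|^2-\bar K_7V_2(x)+K_7V_2(y).$$ (H8) For every $l_2>0$ there is $\hat L_{l_2}>0$ such that $|f(\mathbf 0,y)|+|g(\mathbf 0,y)|\le\hat L_{l_2}|y|$ for all $|y|\le l_2$. Scheme. Fix a strictly increasing continuous function $\hat\Phi:[1,\infty)\to\mathbb{R}_+$ with $\hat\Phi(l)\to\infty$ as $l\to\infty$ such that $$\sup_{|x|\vee|y|\le l}\left(\frac{|f(x,y)|}{|x|+1\wedge|y|}\vee\frac{|g(x,y)|^2}{(|x|+1\wedge|y|)^2}\right)\le\hat\Phi(l),\qquad\forall\,l\ge1$$ (the point $x=y=\mathbf 0$ being disregarded), with inverse $\hat\Phi^{-1}:[\hat\Phi(1),\infty)\to\mathbb{R}_+$. Fix $\mu\in(0,\frac12)$ and set $h_{\hat\Phi,\mu}(\triangle)=\hat K\triangle^{-\mu}$ for $\triangle\in(0,1]$, where $\hat K=\hat\Phi(\|\xi\|\vee1)$.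 Define $\Upsilon^{\triangle}_{\hat\Phi,\mu}(x)=\big(|x|\wedge\hat\Phi^{-1}(h_{\hat\Phi,\mu}(\triangle))\big)\frac{x}{|x|}$, with $\frac{x}{|x|}=\mathbf 0$ for $x=\mathbf 0$. For a positive integer $N$ with $\triangle=\tau/N\in(0,1]$, put $t_i=i\triangle$, $\triangle W_i=W(t_{i+1})-W(t_i)$, and define $y_i^{\triangle}=\xi(i\triangle)$ for $i=-N,\dots,0$, and for $i=0,1,\dots$ $$\hat y_{i+1}^{\triangle}=y_i^{\triangle}+f(y_i^{\triangle},y_{i-N}^{\triangle})\triangle+g(y_i^{\triangle},y_{i-N}^{\triangle})\triangle W_i,\qquad y_{i+1}^{\triangle}=\Upsilon^{\triangle}_{\hat\Phi,\mu}(\hat y_{i+1}^{\triangle}).$$ *)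

(* Defs.v *)
From HB Require Import structures.
From mathcomp Require Import all_boot all_order all_algebra.
From mathcomp Require Import all_classical all_reals all_analysis.

Set Implicit Arguments.
Unset Strict Implicit.
Unset Printing Implicit Defensive.

Import Order.TTheory GRing.Theory Num.Theory.
Import numFieldNormedType.Exports.

Local Open Scope classical_set_scope.
Local Open Scope ring_scope.

(* Euclidean norm on 'cV[R]_d and Hilbert-Schmidt norm on 'M[R]_(d, m). The
   library norm `|A| on matrices is the sup norm, which is equivalent but not
   equal; it induces the same topology. *)
Definition enorm (R : realType) (p q : nat) (A : 'M[R]_(p, q)) : R :=
  Num.sqrt (\sum_(i < p) \sum_(j < q) A i j ^+ 2).

Definition dotp (R : realType) (p : nat) (x y : 'cV[R]_p) : R :=
  \sum_(i < p) x i 0 * y i 0.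

(* On a pointed T, [borel T] is the sigma-algebra of the library's
   measurableType [g_sigma_algebraType (@open T)]; the present form also covers
   'cV[R]_d * 'cV[R]_d, which has no ptopologicalType instance. *)
Definition borel (T : topologicalType) : set_system T := <<s @open T >>.

Definition borel_fun (T U : topologicalType) (f : T -> U) : Prop :=
  forall B : set U, borel B -> borel (f @^-1` B).

Section Brownian.
Context (R : realType) (dO : measure_display) (Omega : measurableType dO)
  (P : probability Omega R).

(* Only the times t >= 0 are relevant. *)
Record filtered_space_usual (F : R -> set_system Omega) : Prop := {
  filtered_sigma : forall t : R, 0 <= t -> sigma_algebra [set: Omega] (F t);
  filtered_sub : forall t : R, 0 <= t -> F t `<=` measurable;
  filtered_mono : forall s t : R, 0 <= s -> s <= t -> F s `<=` F t;
  filtered_complete : measure_is_complete P;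
  filtered_null : P.-negligible `<=` F 0;
  filtered_right_cont : forall t : R, 0 <= t ->
    F t = \bigcap_(s in `]t, +oo[) F s }.

(* In [brownian_normal], independence of the components together with their
   N(0, t - s) laws is the law N(0, (t - s) I_m), described on rectangles; the
   second parameter of [normal_prob] is the standard deviation, and s < t is
   required because [normal_prob 0 0] is not a Dirac mass. *)
Record brownian_motion (m : nat) (F : R -> set_system Omega)
    (W : R -> Omega -> 'cV[R]_m) : Prop := {
  brownian_adapted : forall t : R, 0 <= t ->
    forall B : set 'cV[R]_m, borel B -> F t (W t @^-1` B);
  brownian_start : {ae P, forall w, W 0 w = 0};
  brownian_continuous :
    {ae P, forall w, {within `[0, +oo[, continuous (fun t => W t w)}};
  brownian_indep : forall s t : R, 0 <= s -> s < t ->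
    forall (A : set Omega) (B : set 'cV[R]_m),
    F s A -> borel B ->
    P (A `&` (fun w => W t w - W s w) @^-1` B) =
    (P A * P ((fun w => W t w - W s w)%R @^-1` B))%E;
  brownian_normal : forall s t : R, 0 <= s -> s < t ->
    forall B : 'I_m -> set R, (forall j, measurable (B j)) ->
    P [set w | forall j, B j (W t w j 0 - W s w j 0)] =
    (\prod_(j < m) normal_prob 0 (Num.sqrt (t - s)) (B j))%E }.

End Brownian.

Section Coefficients.
Context (R : realType) (d m : nat).
Local Notation V := 'cV[R]_d.
Context (f : V -> V -> V) (g : V -> V -> 'M[R]_(d, m)).

Definition locally_lipschitz_fst : Prop :=
  forall l : R, 0 < l -> exists2 L : R, 0 < L &
  forall x x' y : V,
    Num.max (Num.max (enorm x) (enorm x')) (enorm y) <= l ->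
    Num.max (enorm (f x y - f x' y)) (enorm (g x y - g x' y))
      <= L * enorm (x - x').

Record delay_dissipative (K6' K6 K7' K7 : R) (V2 : V -> R) : Prop := {
  diss_K6 : 0 < K6;
  diss_K6' : K6 < K6';
  diss_K7 : 0 <= K7;
  diss_K7' : K7 < K7';
  diss_V2_ge0 : forall x, 0 <= V2 x;
  diss_V2_cont : continuous V2;
  diss_ineq : forall x y : V,
    dotp (2 *: x) (f x y) + enorm (g x y) ^+ 2 <=
    - K6' * enorm x ^+ 2 + K6 * enorm y ^+ 2 - K7' * V2 x + K7 * V2 y }.

Definition linear_at_zero_fst : Prop :=
  forall l : R, 0 < l -> exists2 L : R, 0 < L &
  forall y : V, enorm y <= l -> enorm (f 0 y) + enorm (g 0 y) <= L * enorm y.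

Definition growth_ratio (x y : V) : R :=
  Num.max (enorm (f x y) / (enorm x + Num.min 1 (enorm y)))
          (enorm (g x y) ^+ 2 / (enorm x + Num.min 1 (enorm y)) ^+ 2).

Definition growth_domain (l : R) : set (V * V) :=
  [set p | Num.max (enorm p.1) (enorm p.2) <= l /\ p <> (0, 0)].

(* Phi is only relevant on [1, +oo[ and Phiinv on [Phi 1, +oo[. *)
Record growth_control (Phi Phiinv : R -> R) : Prop := {
  Phi_ge0 : forall l : R, 1 <= l -> 0 <= Phi l;
  Phi_incr : {in `[1, +oo[ &, {homo Phi : u v / u < v}};
  Phi_cont : {within `[1, +oo[, continuous Phi};
  Phi_infty : Phi l @[l --> +oo] --> +oo;
  Phi_bound : forall l : R, 1 <= l ->
    (ereal_sup [set (growth_ratio p.1 p.2)%:E | p in growth_domain l]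
     <= (Phi l)%:E)%E;
  Phiinv_ge1 : {in `[Phi 1, +oo[, forall u, 1 <= Phiinv u};
  PhiK : {in `[1, +oo[, cancel Phi Phiinv};
  PhiinvK : {in `[Phi 1, +oo[, cancel Phiinv Phi} }.

End Coefficients.

Section Scheme.
Context (R : realType) (d m : nat).
Local Notation V := 'cV[R]_d.

Definition init_norm (tau : R) (xi : R -> V) : R :=
  sup [set enorm (xi t) | t in `[- tau, 0]].

Definition step_bound (Phi : R -> R) (tau : R) (xi : R -> V) (mu D : R) : R :=
  Phi (Num.max (init_norm tau xi) 1) * D `^ (- mu).

(* 0^-1 = 0, so (enorm x)^-1 *: x is 0 for x = 0 *)
Definition truncation (r : R) (x : V) : V :=
  Num.min (enorm x) r *: ((enorm x)^-1 *: x).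

Record truncated_EM (f : V -> V -> V) (g : V -> V -> 'M[R]_(d, m))
    (tau : R) (xi : R -> V) (Phi Phiinv : R -> R) (mu : R)
    (Omega : Type) (W : R -> Omega -> 'cV[R]_m) (N : nat) (D : R)
    (y : int -> Omega -> V) : Prop := {
  EM_init : forall i : int, - N%:Z <= i <= 0 ->
    forall w, y i w = xi (i%:~R * D);
  EM_step : forall i : nat, forall w,
    y (i%:Z + 1) w =
    truncation (Phiinv (step_bound Phi tau xi mu D))
      (y i%:Z w + D *: f (y i%:Z w) (y (i%:Z - N%:Z) w)
       + g (y i%:Z w) (y (i%:Z - N%:Z) w)
         *m (W (i.+1%:R * D) w - W (i%:R * D) w)) }.

End Scheme.

(* Main.v *)
Require Import Defs.
From HB Require Import structures.
From mathcomp Require Import all_boot all_order all_algebra.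
From mathcomp Require Import all_classical all_reals all_analysis.
From mathcomp Require Import measurable_realfun ring lra.

Set Implicit Arguments.
Unset Strict Implicit.
Unset Printing Implicit Defensive.

Import Order.TTheory GRing.Theory Num.Theory.
Import numFieldNormedType.Exports.

Local Open Scope classical_set_scope.
Local Open Scope ring_scope.

(** The idea is a discrete Lyapunov (Halanay) estimate carried out path by path,
so that expectations are taken only at the very end.

Write [a = y_i], [b = y_(i-N)] and [z] for the Brownian increment of step [i].
Expanding the square of the Euler step gives
[|a + D f + g z|^2 = |a|^2 + D (2 <a, f> + |g|^2) + D^2 |f|^2 + G_i]
([sqr_enorm_em_step]), where [G_i] collects the terms [z_j z_l - D delta_jl]
and [z_j], multiplied by coefficients known at time [t_i]
([scheme_noise]).  The truncation does not increase norms, and it keeps the whole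
trajectory in the ball whose radius [r] satisfies [Phi r = Khat D^(-mu)]; the
growth control on that ball gives
[D^2 |f|^2 <= D (2 Khat^2 D^(1 - 2 mu)) (|a|^2 + |b|^2)].  As [mu < 1/2], the
bracket is at most any prescribed [eta > 0] for small [D], so that the
dissipativity condition survives the discretisation with [K6'] and [K6] replaced
by [K6' - eta] and [K6 + eta] ([scheme_dissipation]).

Summing these inequalities with the weights [exp (lam t_(i+1))], where
[lam = gamma - eps], the delayed terms reappear [N] steps later multiplied by
[exp (lam tau)] and are absorbed by the dissipation as soon as
[eta (1 + exp (gamma tau)) <= eps] ([discrete_halanay]).  For every path this
gives [exp (lam t_n) |y_n|^2 <= C + sum_(i < n) exp (lam t_(i+1)) G_i] with [C]
depending only on the initial segment and on the constants.

It remains to see that [G_i] is integrable with mean zero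
([has_mean_em_noise]).  Its coefficients are bounded, because the scheme is, and
measurable for the past, because the scheme is adapted
([shifted_scheme_adapted]); the increment is independent of the past, and its
coordinates are independent [N(0, D)] variables.  The expectation of a product of
independent variables is the product of the expectations ([has_mean_indepM]),
and the first two moments of the normal law are computed in
[has_mean_normal_id] and [has_mean_normal_sqr]. *)

(** * Moments of the centred normal law *)

Section normal_moments.
Variables (R : realType) (s : R).
Hypothesis s0 : 0 < s.
Let mu := @lebesgue_measure R.
Let q := normal_pdf 0 s.

Let q_ge0 x : 0 <= q x. Proof. exact: normal_pdf_ge0. Qed.
Let mq : measurable_fun setT q. Proof. exact: measurable_normal_pdf. Qed.
Let cq : continuous q. Proof. by apply: continuous_normal_pdf; rewrite gt_eqF. Qed.
Let qE x : q x = normal_peak s * expR (- x ^+ 2 / (s ^+ 2 *+ 2)).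
Proof. by rewrite /q normal_pdfE ?gt_eqF// /normal_fun subr0. Qed.
Let qN x : q (- x) = q x. Proof. by rewrite !qE sqrrN. Qed.

(** The density of [normal_prob] is a Radon-Nikodym derivative with respect to the
Lebesgue measure, hence a version of the one for which the change of variables
formula is known. *)
Lemma ge0_integral_normal_prob (h : R -> \bar R) :
  (forall x, 0 <= h x)%E -> measurable_fun [set: R] h ->
  (\int[normal_prob 0 s]_x h x = \int[mu]_x (h x * (q x)%:E))%E.
Proof.
move=> h0 mh.
have dom : @normal_prob R 0 s `<< mu by exact: normal_prob_dominates.
rewrite -(Radon_Nikodym_SigmaFinite.change_of_variables dom)//.
have mEq : measurable_fun setT (EFin \o q) by exact/measurable_EFinP.
have irn := Radon_Nikodym_SigmaFinite.f_integrable dom.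
apply: ae_eq_integral => //=.
- by apply: emeasurable_funM => //; exact: measurable_int irn.
- exact: emeasurable_funM.
- apply: ae_eqe_mul2l; apply: integral_ae_eq => //.
  by move=> E _ mE; rewrite -Radon_Nikodym_SigmaFinite.f_integral.
Qed.

Let dq (x : R) : is_derive x 1 q (- (x / s ^+ 2) * q x).
Proof.
pose u (x : R) : R := - (s ^+ 2 *+ 2)^-1 * x ^+ 2.
have du : is_derive x 1 u (- (x / s ^+ 2)).
  apply: is_derive_eq; rewrite /GRing.scale/=.
  by field; rewrite gt_eqF.
have de : is_derive x 1 (expR \o u) (- (x / s ^+ 2) * expR (u x)).
  by apply: is_derive_eq; rewrite /GRing.scale/= mulrC.
have -> : q = (fun x => normal_peak s * (expR \o u) x).
  apply/funext => y; rewrite qE /u/=; congr (_ * expR _).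
  by rewrite mulNr mulrC mulNr.
by apply: is_derive_eq; rewrite /GRing.scale/= mulrCA.
Qed.

Let dxq (x : R) :
  is_derive x 1 (fun x => s ^+ 2 * (x * q x)) ((s ^+ 2 - x ^+ 2) * q x).
Proof.
have dq' := dq x.
have d1 : is_derive x 1 (fun x : R => x * q x) (q x - x ^+ 2 / s ^+ 2 * q x).
  apply: is_derive_eq; rewrite /GRing.scale/=; ring.
by apply: is_derive_eq; rewrite /GRing.scale/=; field; rewrite gt_eqF.
Qed.

Let xq_cvg0 : (x * q x) @[x --> +oo] --> (0 : R).
Proof.
pose c := normal_peak s * (s ^+ 2 *+ 2).
apply: (@squeeze_cvgr _ _ _ _ (cst 0) (fun x : R => c * x^-1)).
- near=> x; have x0 : 0 < x by near: x; exact: nbhs_pinfty_gt.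
  rewrite /cst mulr_ge0 ?q_ge0 ?(ltW x0)//= qE.
  have e0 : 0 < s ^+ 2 *+ 2 by rewrite pmulrn_lgt0// exprn_gt0.
  have : expR (- x ^+ 2 / (s ^+ 2 *+ 2)) <= (s ^+ 2 *+ 2) / x ^+ 2.
    rewrite mulNr expRN -[leRHS]invf_div lef_pV2 ?posrE ?expR_gt0//; last first.
      by rewrite divr_gt0// exprn_gt0.
    by rewrite (le_trans _ (expR_ge1Dx _))// lerDr.
  move=> /(ler_wpM2l (normal_peak_ge0 s)) /(ler_wpM2l (ltW x0)) /le_trans; apply.
  rewrite /c le_eqVlt; apply/orP; left; apply/eqP; field.
  by rewrite gt_eqF.
- exact: cvg_cst.
- rewrite -[X in _ --> X](mulr0 c); apply: cvgMr.
  by apply/gtr0_cvgV0; [exact: nbhs_pinfty_gt|exact: cvg_id].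
Unshelve. all: by end_near. Qed.

Let mqX (h : R -> R) (D : set R) : continuous h ->
  measurable_fun D (fun x => (h x * q x)%:E).
Proof.
move=> ch; apply: measurable_funTS; apply/measurable_EFinP.
by apply: measurable_funM => //; exact: continuous_measurable_fun.
Qed.

Let cX n : continuous (fun x : R => x ^+ n).
Proof. by move=> x; exact: exprn_continuous. Qed.

(** On the half-line, [x^2 - s^2] times the density has the primitive
[- s^2 x q x], which vanishes at both ends; the sign change of [x^2 - s^2] at
[s] is why the half-line is cut there. *)
Lemma integral_sqr_normal_pdf0y :
  (\int[mu]_(x in `[0%R, +oo[) (x ^+ 2 * q x)%:E =
  \int[mu]_(x in `[0%R, +oo[) (s ^+ 2 * q x)%:E)%E.
Proof.
have cc : continuous (fun _ : R => s ^+ 2 : R) by move=> x; exact: cvg_cst.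
have cf1 : continuous (fun x : R => (s ^+ 2 - x ^+ 2) * q x).
  move=> x; apply: cvgM; last exact: cq.
  by apply: cvgB; [exact: cvg_cst|exact: cX].
have cf2 : continuous (fun x : R => (x ^+ 2 - s ^+ 2) * q x).
  move=> x; apply: cvgM; last exact: cq.
  by apply: cvgB; [exact: cX|exact: cvg_cst].
have cF : continuous (fun x : R => s ^+ 2 * (x * q x)).
  move=> x; apply: cvgM; first exact: cvg_cst.
  by apply: cvgM; [exact: cvg_id|exact: cq].
pose A : R := s ^+ 2 * (s * q s).
have I1 : (\int[mu]_(x in `[0%R, s]) ((s ^+ 2 - x ^+ 2) * q x)%:E = A%:E)%E.
  rewrite (@continuous_FTC2 _ _ (fun x => s ^+ 2 * (x * q x)))//.
  - by rewrite mul0r mulr0 sube0.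
  - exact: continuous_subspaceT.
  - split; first by move=> x _; have [] := dxq x.
      by apply: cvg_at_right_filter; exact: cF.
    by apply: cvg_at_left_filter; exact: cF.
  - by move=> x _; rewrite derive1E; have [_ ->] := dxq x.
have I2 : (\int[mu]_(x in `[s, +oo[) ((x ^+ 2 - s ^+ 2) * q x)%:E = A%:E)%E.
  rewrite (@ge0_continuous_FTC2y _ _ (- (fun x => s ^+ 2 * (x * q x))) _ 0)//.
  - by rewrite -EFinB sub0r; congr EFin; rewrite opprK.
  - move=> x sx; rewrite mulr_ge0 ?q_ge0// subr_ge0.
    by rewrite lerXn2r// nnegrE ltW// (lt_le_trans s0).
  - exact: continuous_subspaceT.
  - rewrite -oppr0; apply: cvgN; rewrite -(mulr0 (s ^+ 2)).
    by apply: cvgMr.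
  - by move=> x _; apply: derivableN; have [] := dxq x.
  - by apply: cvgN; apply: cvg_at_right_filter; exact: cF.
  - move=> x _; rewrite derive1E deriveN; last by have [] := dxq x.
    by have [_ ->] := dxq x; rewrite -mulNr opprB.
have split (h : R -> R) : continuous h -> (forall x, 0 <= h x) ->
    (\int[mu]_(x in `[0%R, +oo[) (h x * q x)%:E =
     \int[mu]_(x in `[0%R, s]) (h x * q x)%:E +
     \int[mu]_(x in `[s, +oo[) (h x * q x)%:E)%E.
  move=> ch h0; rewrite -[X in (_ + X)%E]integral_itv_obnd_cbnd; last exact: mqX.
  rewrite (@itv_bndbnd_setU _ _ _ (BRight s)) ?bnd_simp ?ltW//.
  rewrite ge0_integral_setU//=; first exact: mqX.
    by move=> x _; rewrite lee_fin mulr_ge0.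
  apply/disj_setPS => y [/=]; rewrite 2!in_itv/= => /andP[_ ys] /andP[].
  by rewrite ltNge ys.
rewrite !split//; last 2 first.
- by move=> x; exact: sqr_ge0.
- by move=> x; exact: sqr_ge0.
rewrite [in RHS](_ : \int[mu]_(x in `[0%R, s]) (s ^+ 2 * q x)%:E =
  A%:E + \int[mu]_(x in `[0%R, s]) (x ^+ 2 * q x)%:E)%E; last first.
  rewrite -I1 -ge0_integralD//=.
  - by apply: eq_integral => x _; rewrite -EFinD -mulrDl subrK.
  - move=> x; rewrite in_itv/= => /andP[x0 xs]; rewrite lee_fin mulr_ge0//.
    by rewrite subr_ge0 lerXn2r// nnegrE ltW.
  - by apply/measurable_funTS/measurable_EFinP; exact: continuous_measurable_fun.
  - by move=> x _; rewrite lee_fin mulr_ge0// sqr_ge0.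
  - exact: mqX.
rewrite [in LHS](_ : \int[mu]_(x in `[s, +oo[) (x ^+ 2 * q x)%:E =
  A%:E + \int[mu]_(x in `[s, +oo[) (s ^+ 2 * q x)%:E)%E; last first.
  rewrite -I2 -ge0_integralD//=.
  - by apply: eq_integral => x _; rewrite -EFinD -mulrDl subrK.
  - move=> x; rewrite in_itv/= andbT => sx; rewrite lee_fin mulr_ge0//.
    by rewrite subr_ge0 lerXn2r// nnegrE ltW// (lt_le_trans s0).
  - by apply/measurable_funTS/measurable_EFinP; exact: continuous_measurable_fun.
  - by move=> x _; rewrite lee_fin mulr_ge0// sqr_ge0.
  - exact: mqX.
by rewrite addeCA addeA.
Qed.

Lemma normal_prob_sqr :
  (\int[normal_prob 0 s]_x (x ^+ 2)%:E = (s ^+ 2)%:E)%E.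
Proof.
rewrite ge0_integral_normal_prob; last 2 first.
- by move=> x; rewrite lee_fin sqr_ge0.
- by apply/measurable_EFinP; exact: continuous_measurable_fun.
have even (h : R -> R) : continuous h -> (forall x, 0 <= h x) ->
    (forall x, h (- x) = h x) ->
    (\int[mu]_x (h x * q x)%:E =
     2%:E * \int[mu]_(x in `[0%R, +oo[) (h x * q x)%:E)%E.
  move=> ch h0 hN; rewrite ge0_symfun_integralT ?set_itvcy//.
  - by move=> x; rewrite mulr_ge0.
  - by move=> x; apply: cvgM; [exact: ch|exact: cq].
  - by move=> x /=; rewrite hN qN.
under eq_integral do rewrite -EFinM.
rewrite even//; last 2 first.
- by move=> x; exact: sqr_ge0.
- by move=> x; rewrite sqrrN.
rewrite integral_sqr_normal_pdf0y -even//; last 2 first.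
- by move=> x; exact: cvg_cst.
- by move=> x; exact: sqr_ge0.
under eq_integral do rewrite EFinM.
rewrite ge0_integralZl//; last 2 first.
- by move=> x _; rewrite lee_fin.
- by rewrite lee_fin sqr_ge0.
  by rewrite integral_normal_pdf mule1.
exact/measurable_EFinP.
Qed.

End normal_moments.

(** * Expectations and independence *)

(** Integrability is part of the notion, so that it is stable under linear
combinations and products of independent variables without side conditions. *)
Definition has_mean d (T : measurableType d) (R : realType)
    (P : probability T R) (X : T -> R) (c : R) : Prop :=
  P.-integrable setT (EFin \o X) /\ (\int[P]_w (X w)%:E = c%:E)%E.

Lemma has_mean_measurable d (T : measurableType d) (R : realType)
    (P : probability T R) (X : T -> R) (a : R) :
  has_mean P X a -> measurable_fun setT X.
Proof. by case=> /measurable_int /measurable_EFinP. Qed.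

Section has_mean.
Context d (T : measurableType d) (R : realType) (P : probability T R).
Implicit Types (X Y Z : T -> R) (a b c : R).

Lemma has_mean_cst c : has_mean P (fun=> c) c.
Proof.
split; first exact: finite_measure_integrable_cst.
by rewrite integral_cst//= probability_setT mule1.
Qed.

Lemma has_meanD X Y a b : has_mean P X a -> has_mean P Y b ->
  has_mean P (fun w => X w + Y w) (a + b).
Proof.
move=> [iX eX] [iY eY]; split.
  by apply: eq_integrable (integrableD _ iX iY).
by under eq_integral do rewrite EFinD; rewrite integralD// eX eY.
Qed.

Lemma has_meanZ k X a : has_mean P X a -> has_mean P (fun w => k * X w) (k * a).
Proof.
move=> [iX eX]; split.
  by apply: eq_integrable (integrableZl _ k iX).
by under eq_integral do rewrite EFinM; rewrite integralZl// eX.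
Qed.

Lemma has_mean_sum I (s : seq I) (X : I -> T -> R) (a : I -> R) :
  (forall i, has_mean P (X i) (a i)) ->
  has_mean P (fun w => \sum_(i <- s) X i w) (\sum_(i <- s) a i).
Proof.
move=> Xa; elim: s => [|i s IH].
  rewrite big_nil; under eq_fun do rewrite big_nil.
  exact: has_mean_cst.
by rewrite big_cons; under eq_fun do rewrite big_cons; exact: has_meanD.
Qed.

Lemma has_mean_bounded X M : measurable_fun setT X ->
  (forall w, `|X w| <= M) -> exists a, has_mean P X a.
Proof.
move=> mX XM.
have iX : P.-integrable setT (EFin \o X).
  apply: (le_integrable measurableT (g := EFin \o cst M)) => //.
  - exact/measurable_EFinP.
  - by move=> w _ /=; rewrite lee_fin (le_trans (XM w)) ?ler_norm.
  - exact: finite_measure_integrable_cst.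
by exists (fine (\int[P]_w (X w)%:E)); split => //; rewrite fineK// integrable_fin_num.
Qed.

Section law.
Context d' (T' : measurableType d') (Q : probability T' R) (Z : T -> T').
Hypothesis mZ : measurable_fun setT Z.
Hypothesis PZ : forall B, measurable B -> P (Z @^-1` B) = Q B.

Lemma has_mean_law (h : T' -> R) c :
  has_mean Q h c -> has_mean P (h \o Z) c.
Proof.
move=> Qh; have mh := has_mean_measurable Qh; case: Qh => ih eh.
have eqPQ (g : T' -> \bar R) :
    (\int[pushforward P Z]_x g x = \int[Q]_x g x)%E.
  by apply: eq_measure_integral => A mA _; exact: PZ.
have iZ : P.-integrable setT (EFin \o (h \o Z)).
  apply/integrableP; split; first by apply/measurable_EFinP/measurableT_comp.
  have /integrableP[_] := ih; rewrite -eqPQ ge0_integral_pushforward//.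
  by apply: measurableT_comp => //; exact/measurable_EFinP.
split=> //; rewrite -eh -eqPQ integral_pushforward//.
exact/measurable_EFinP.
Qed.

End law.

(** Independence makes the law of the pair [(X, Z)] the product of the marginal
laws, so that the product formula for expectations is Fubini's theorem for the
function [(x, z) |-> x z]. *)
Lemma has_mean_indepM X Z a b :
  (forall A B : set R, measurable A -> measurable B ->
     P (X @^-1` A `&` Z @^-1` B) = (P (X @^-1` A) * P (Z @^-1` B))%E) ->
  has_mean P X a -> has_mean P Z b -> has_mean P (fun w => X w * Z w) (a * b).
Proof.
move=> indXZ Xa Zb.
have mX := has_mean_measurable Xa; have mZ := has_mean_measurable Zb.
pose m1 := distribution P (mfun_Sub (mem_set mX)).
pose m2 := distribution P (mfun_Sub (mem_set mZ)).
have mXZ : measurable_fun setT (fun w => (X w, Z w)) by exact: measurable_fun_pair.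
pose m12 := distribution P (mfun_Sub (mem_set mXZ)).
have m12E A : measurable A -> (m1 \x m2)%E A = m12 A.
  by apply: product_measure_unique => A1 A2 mA1 mA2; exact: indXZ.
have int12 (h : R * R -> \bar R) :
    (\int[m12]_z h z = \int[m1 \x m2]_z h z)%E.
  by apply: eq_measure_integral => A mA _; apply: esym; exact: m12E.
have m1X : has_mean m1 id a.
  case: Xa => iX eX; split; last first.
    by rewrite -eX integral_pushforward//; exact/measurable_EFinP.
  by apply: integrable_pushforward => //; exact/measurable_EFinP.
have m2Z : has_mean m2 id b.
  case: Zb => iZ eZ; split; last first.
    by rewrite -eZ integral_pushforward//; exact/measurable_EFinP.
  by apply: integrable_pushforward => //; exact/measurable_EFinP.
pose h (z : R * R) := (z.1 * z.2)%:E.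
have mh : measurable_fun setT h.
  by apply/measurable_EFinP; apply: measurable_funM; [exact: measurable_fst|exact: measurable_snd].
case: m1X => /integrableP[_ i1] e1; case: m2Z => i2 e2.
have /integrableP[_ i2'] := i2.
have ih : (m1 \x m2)%E.-integrable setT h.
  apply/integrable12ltyP => //.
  under eq_integral => x _.
    under eq_integral => y _ do rewrite /h/= normrM EFinM.
    rewrite ge0_integralZl//; last exact: measurableT_comp.
    over.
  rewrite ge0_integralZr//; last 2 first.
  - exact: measurableT_comp.
  - exact: integral_ge0.
  by rewrite lte_mul_pinfty ?integral_ge0// ge0_fin_numE// integral_ge0.
split.
  apply/integrableP; split.
    by apply/measurable_EFinP; exact: measurable_funM.
  have /integrableP[_] := ih; rewrite -int12 ge0_integral_pushforward//.
  exact: measurableT_comp.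
transitivity (\int[m12]_z h z)%E.
  rewrite integral_pushforward//.
  apply/integrableP; split.
    by apply/measurable_EFinP; exact: measurable_funM.
  have /integrableP[_] := ih; rewrite -int12 ge0_integral_pushforward//.
  exact: measurableT_comp.
rewrite int12 -integral12_prod_meas1// /fubini_F.
under eq_integral => x _.
  under eq_integral => y _ do rewrite /h/= EFinM.
  rewrite integralZl// e2; over.
by rewrite integralZr// ?e1//; apply/integrableP.
Qed.

End has_mean.

Lemma expectation_le_mean d (T : measurableType d) (R : realType) (P : probability T R)
    (X Z : T -> R) c : measurable_fun setT X -> (forall w, 0 <= X w) ->
  (forall w, X w <= Z w) -> has_mean P Z c -> ('E_P[X] <= c%:E)%E.
Proof.
move=> mX X0 XZ Zc; have mZ := has_mean_measurable Zc; case: Zc => _ <-.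
rewrite unlock; apply: ge0_le_integral => //.
- by move=> w _; rewrite lee_fin.
- exact/measurable_EFinP.
- exact/measurable_EFinP.
- by move=> w _; rewrite lee_fin.
Qed.

Section normal_mean.
Variables (R : realType) (s : R).
Hypothesis s0 : 0 < s.
Let N := @normal_prob R 0 s.

Lemma has_mean_normal_sqr : has_mean N (fun x => x ^+ 2) (s ^+ 2).
Proof.
have mX : measurable_fun setT (EFin \o (fun x : R => x ^+ 2)).
  by apply/measurable_EFinP; exact: exprn_measurable.
split; last exact: normal_prob_sqr.
apply/integrableP; split=> //.
under eq_integral do rewrite /= ger0_norm ?sqr_ge0//.
by rewrite normal_prob_sqr// ltry.
Qed.

(** The normal law is invariant under [x |-> - x], so that its mean equals its own
opposite; integrability follows from that of the square. *)
Lemma has_mean_normal_id : has_mean N id 0.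
Proof.
have symN (A : set R) : measurable A -> N (-%R @^-1` A) = N A.
  move=> mA; rewrite /N /normal_prob.
  have qN x : normal_pdf 0 s (- x) = normal_pdf 0 s x.
    by rewrite !normal_pdfE ?gt_eqF// /normal_fun !subr0 sqrrN.
  under eq_integral do rewrite -qN.
  rewrite -(@ge0_integral_pushforward _ _ (measurableTypeR R)
    (measurableTypeR R) R -%R (@oppr_measurable R setT) lebesgue_measure A
    (fun x => (normal_pdf 0 s x)%:E))//.
  - apply: eq_measure_integral => B mB _; exact: lebesgue_measureN.
  - apply: measurable_funTS; apply/measurable_EFinP; exact: measurable_normal_pdf.
  - by move=> x _; rewrite lee_fin normal_pdf_ge0.
have iN : N.-integrable setT (EFin \o (id : R -> R)).
  apply: (@le_integrable _ _ R N setT measurableT _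
    (EFin \o (fun x : R => 1 + x ^+ 2))); last 1 first.
  - by have [] := has_meanD (has_mean_cst N 1) has_mean_normal_sqr.
  - by apply/measurable_EFinP.
  - move=> x _ /=; rewrite lee_fin [leRHS]ger0_norm ?addr_ge0 ?sqr_ge0//.
    rewrite -[x ^+ 2]real_normK ?num_real//.
    have := sqr_ge0 (`|x| - 1); have := normr_ge0 x; nra.
have Na : has_mean N id (fine (\int[N]_x x%:E)).
  by split => //; rewrite fineK// integrable_fin_num.
have Na' := has_meanZ (-1) Na.
set a := fine _ in Na Na'.
have Na2 := @has_mean_law _ _ _ N _ _ N (-%R) _ symN id a Na.
have [_ e1] := Na2 (@oppr_measurable R setT); have [_ e2] := Na'.
have : a%:E = (-1 * a)%:E.
  by rewrite -e1 -e2; apply: eq_integral => x _; rewrite /= mulN1r.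
by case=> aN; have a0 : a = 0 by [lra]; rewrite a0 in Na.
Qed.

End normal_mean.

(** * Borel functions of finitely many coordinates *)

Section borel_measurability.
Context (R : realType).

(** The sets with a measurable preimage form a sigma-algebra. *)
Lemma open_preimage_measurable d (T : measurableType d) (U : topologicalType)
    (h : T -> U) :
  (forall B : set U, open B -> measurable (h @^-1` B)) ->
  forall B : set U, borel B -> measurable (h @^-1` B).
Proof.
move=> hopen B; apply: (smallest_sub (X := [set B | measurable (h @^-1` B)])).
  split => /=.
  - by rewrite preimage_set0.
  - by move=> A mA; rewrite setTD preimage_setC; exact: measurableC.
  - by move=> F mF; rewrite preimage_bigcup; exact: bigcupT_measurable.
by move=> A oA; exact: hopen.
Qed.

Lemma continuous_preimage_borel (V : ptopologicalType) (phi : V -> R)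
    (A : set R) : continuous phi -> measurable A -> borel (phi @^-1` A).
Proof.
move=> /continuousP cphi mA.
have : measurable_fun setT (phi : g_sigma_algebraType (@open V) -> R).
  apply: (measurability _ (RGenOpens.measurableE R)) => _ [_ [x [y ->]] <-].
  rewrite setTI; apply: sub_sigma_algebra; apply: cphi; exact: interval_open.
by move=> /(_ measurableT A mA); rewrite setTI.
Qed.

(** Open sets of a finite-dimensional space are countable unions of boxes with
rational centres, and boxes are described coordinatewise. *)
Lemma borel_pair_measurable d (T : measurableType d) (n : nat)
    (X Y : T -> 'cV[R]_n) :
  (forall i, measurable_fun setT (fun w => X w i 0)) ->
  (forall i, measurable_fun setT (fun w => Y w i 0)) ->
  forall B : set ('cV[R]_n * 'cV[R]_n), borel B ->
  measurable ((fun w => (X w, Y w)) @^-1` B).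
Proof.
move=> mX mY; apply: open_preimage_measurable => U oU.
pose box (q : 'cV[rat]_n) (k : nat) : set 'cV[R]_n :=
  [set x | forall i, `|x i 0 - ratr (q i 0)| < k.+1%:R^-1].
have mbox (Z : T -> 'cV[R]_n) q k :
    (forall i, measurable_fun setT (fun w => Z w i 0)) ->
    measurable (Z @^-1` box q k).
  move=> mZ; have -> : Z @^-1` box q k = \bigcap_(i in [set: 'I_n])
      ((fun w => Z w i 0) @^-1` ball (ratr (q i 0) : R) k.+1%:R^-1).
    apply/seteqP; split=> w /= Zw i; first by move=> _; rewrite /ball/= distrC.
    by have := Zw i I; rewrite /ball/= distrC.
  apply: fin_bigcap_measurable => // i _; rewrite -[X in measurable X]setTI.
  by apply: mZ => //; exact: measurable_ball.
have boxP (x : 'cV[R]_n) k : exists q, box q k x.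
  have /choice[q qx] i : exists r : rat, `|x i 0 - ratr r| < k.+1%:R^-1.
    have [r] : exists r : rat, ratr r \in `]x i 0 - k.+1%:R^-1, x i 0 + k.+1%:R^-1[.
      apply: rat_in_itvoo; rewrite ltrD2l gtrN ?invr_gt0//.
    by rewrite in_itv/= => xr; exists r; rewrite distrC ltr_distl.
  by exists (\col_i q i) => i; rewrite mxE.
pose G (qk : 'cV[rat]_n * 'cV[rat]_n * nat) : set T :=
  if pselect (forall p, box qk.1.1 qk.2 p.1 -> box qk.1.2 qk.2 p.2 -> U p)
  then X @^-1` box qk.1.1 qk.2 `&` Y @^-1` box qk.1.2 qk.2 else set0.
have -> : (fun w => (X w, Y w)) @^-1` U = \bigcup_qk G qk.
  apply/seteqP; split=> [w /= Uw|w [qk _]]; last first.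
    by rewrite /G; case: pselect => // sub [? ?]; exact: (sub (_, _)).
  have /nbhs_ballP[e /= e0 eU] : nbhs (X w, Y w) U by exact: open_nbhs_nbhs.
  have [k ke] : exists k : nat, k.+1%:R^-1 + k.+1%:R^-1 <= e.
    have [k kP] := @ltr_add_invr R 0 (e / 2) (divr_gt0 e0 (ltr0n _ 2)).
    by exists k; rewrite add0r in kP; set u := _^-1 in kP *; lra.
  have [q1 b1] := boxP (X w) k; have [q2 b2] := boxP (Y w) k.
  exists (q1, q2, k) => //; rewrite /G/=; case: pselect => //= -[] [p1 p2] /= c1 c2.
  have tri (q x p : R) : `|x - q| < k.+1%:R^-1 -> `|p - q| < k.+1%:R^-1 ->
      `|x - p| < e.
    move: ke; set u := _^-1 => ke xq pq.
    by have := ler_distD q x p; rewrite [`|q - p|]distrC; lra.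
  apply: eU; split; split => // i j; rewrite (ord1 j) /ball/=.
    exact: tri (b1 i) (c1 i).
  exact: tri (b2 i) (c2 i).
apply: countable_bigcupT_measurable; first exact: countableP.
rewrite /G => -[[q1 q2] k]; case: pselect => /= [?|?] //.
by apply: measurableI; exact: mbox.
Qed.

Lemma borel_fun_measurable d (T : measurableType d) (n p q : nat)
    (f : 'cV[R]_n -> 'cV[R]_n -> 'M[R]_(p, q)) (X Y : T -> 'cV[R]_n) :
  borel_fun (fun u : 'cV[R]_n * 'cV[R]_n => f u.1 u.2) ->
  (forall i, measurable_fun setT (fun w => X w i 0)) ->
  (forall i, measurable_fun setT (fun w => Y w i 0)) ->
  forall i j, measurable_fun setT (fun w => f (X w) (Y w) i j).
Proof.
move=> bf mX mY i j _ A mA; rewrite setTI.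
have bA := continuous_preimage_borel (@coord_continuous R p q i j) mA.
exact: (borel_pair_measurable mX mY (bf _ bA)).
Qed.

Lemma measurable_enorm d (T : measurableType d) (p q : nat)
    (X : T -> 'M[R]_(p, q)) :
  (forall i j, measurable_fun setT (fun w => X w i j)) ->
  measurable_fun setT (fun w => enorm (X w)).
Proof.
move=> mX; apply: measurableT_comp.
  by apply: continuous_measurable_fun; exact: sqrt_continuous.
by apply: measurable_sum => i; apply: measurable_sum => j; exact: measurable_funX.
Qed.

Lemma measurable_truncation d (T : measurableType d) (n : nat) (r : R)
    (X : T -> 'cV[R]_n) :
  (forall i, measurable_fun setT (fun w => X w i 0)) ->
  forall i, measurable_fun setT (fun w => truncation r (X w) i 0).
Proof.
move=> mX i.
have mN : measurable_fun setT (fun w => enorm (X w)).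
  by apply: measurable_enorm => k j; rewrite ord1.
(* The inverse of a nonnegative number is its power [-1], a measurable
   function also at [0]. *)
have -> : (fun w => truncation r (X w) i 0) =
    (fun w => Num.min (enorm (X w)) r * (enorm (X w) `^ (-1) * X w i 0)).
  by apply/funext => w; rewrite /truncation !mxE powR_inv1 ?sqrtr_ge0.
apply: measurable_funM; first by apply: measurable_minr.
apply: measurable_funM => //.
exact: (measurableT_comp (measurable_powR (-1)) mN).
Qed.

End borel_measurability.

(** * The square of an Euler step, and a discrete Halanay inequality *)

Section enorm_theory.
Context (R : realType).

Lemma enorm_ge0 p q (A : 'M[R]_(p, q)) : 0 <= enorm A.
Proof. exact: sqrtr_ge0. Qed.

Lemma sqr_enorm p q (A : 'M[R]_(p, q)) :
  enorm A ^+ 2 = \sum_(i < p) \sum_(j < q) A i j ^+ 2.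
Proof.
by rewrite sqr_sqrtr// sumr_ge0// => i _; rewrite sumr_ge0// => j _; exact: sqr_ge0.
Qed.

Lemma sqr_enorm_cV p (x : 'cV[R]_p) : enorm x ^+ 2 = \sum_(i < p) x i 0 ^+ 2.
Proof. by rewrite sqr_enorm; apply: eq_bigr => i _; rewrite big_ord1. Qed.

Lemma ler_coord_enorm p q (A : 'M[R]_(p, q)) i j : `|A i j| <= enorm A.
Proof.
rewrite -(@ler_pXn2r _ 2)// ?nnegrE ?enorm_ge0// real_normK ?num_real// sqr_enorm.
rewrite (bigD1 i)//= (bigD1 j)//= -addrA lerDl addr_ge0//.
  by rewrite sumr_ge0// => k _; exact: sqr_ge0.
by apply: sumr_ge0 => k _; apply: sumr_ge0 => l _; exact: sqr_ge0.
Qed.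

Lemma enorm_eq0 p (x : 'cV[R]_p) : enorm x = 0 -> x = 0.
Proof.
move=> x0; apply/matrixP => i j; rewrite mxE; apply/eqP.
by rewrite -normr_le0 -x0 ler_coord_enorm.
Qed.

Lemma enormZ p q k (A : 'M[R]_(p, q)) : enorm (k *: A) = `|k| * enorm A.
Proof.
apply/eqP; rewrite -(@eqrXn2 _ 2)// ?mulr_ge0 ?enorm_ge0//; apply/eqP.
rewrite exprMn real_normK ?num_real// !sqr_enorm mulr_sumr.
apply: eq_bigr => i _; rewrite mulr_sumr; apply: eq_bigr => j _.
by rewrite mxE exprMn.
Qed.

Lemma enorm_truncation p r (x : 'cV[R]_p) : 0 <= r ->
  enorm (truncation r x) = Num.min (enorm x) r.
Proof.
move=> r0; rewrite /truncation !enormZ normfV (ger0_norm (enorm_ge0 x)).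
rewrite ger0_norm ?le_min ?enorm_ge0//.
have [x0|x0] := eqVneq (enorm x) 0; last by rewrite mulVf// mulr1.
by rewrite x0 mulr0 mulr0 min_l.
Qed.

(** The fluctuation of [|a + D f + g z|^2] around its conditional mean when [z]
has independent centred coordinates of variance [D]; [b] stands for [a + D f]. *)
Definition em_noise d m (D : R) (b : 'cV[R]_d) (g : 'M[R]_(d, m))
    (z : 'cV[R]_m) : R :=
  \sum_(k < d) (\sum_(j < m) \sum_(l < m)
      g k j * g k l * (z j 0 * z l 0 - D * (j == l)%:R) +
    \sum_(j < m) 2 * b k 0 * g k j * z j 0).

(** The [D * |g|^2] on the right is the conditional mean of [|g z|^2]; subtracting
it on the diagonal of [em_noise] makes each term of that sum centred. *)
Lemma sqr_enorm_em_step d m (D : R) (a f : 'cV[R]_d) (g : 'M[R]_(d, m))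
    (z : 'cV[R]_m) :
  enorm (a + D *: f + g *m z) ^+ 2 =
  enorm a ^+ 2 + D * (dotp (2 *: a) f + enorm g ^+ 2) + D ^+ 2 * enorm f ^+ 2
  + em_noise D (a + D *: f) g z.
Proof.
rewrite !sqr_enorm_cV sqr_enorm /dotp /em_noise.
rewrite mulrDr !mulr_sumr -!big_split/=; apply: eq_bigr => k _.
rewrite [(_ + g *m z) k 0]mxE.
have -> : (g *m z) k 0 = \sum_(j < m) g k j * z j 0 by rewrite mxE.
have -> : \sum_(j < m) \sum_(l < m)
    g k j * g k l * (z j 0 * z l 0 - D * (j == l)%:R) =
    (\sum_(j < m) g k j * z j 0) ^+ 2 - D * \sum_(j < m) g k j ^+ 2.
  rewrite expr2 mulr_suml mulr_sumr -sumrB; apply: eq_bigr => j _.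
  rewrite mulr_sumr.
  under eq_bigr do rewrite mulrBr; rewrite sumrB; congr (_ - _).
    by apply: eq_bigr => l _; ring.
  rewrite (bigD1 j)//= big1 ?addr0; first by rewrite eqxx mulr1; ring.
  by move=> l lj; rewrite eq_sym (negbTE lj) !mulr0.
have -> : \sum_(j < m) 2 * (a + D *: f) k 0 * g k j * z j 0 =
    2 * (a + D *: f) k 0 * (\sum_(j < m) g k j * z j 0).
  by rewrite mulr_sumr; apply: eq_bigr => j _; ring.
rewrite !mxE; ring.
Qed.

End enorm_theory.

(** With [s n := expR (lam n D)], the quantity
[s n * a (n + N) + D * \sum_(n <= i < n + N) s i.+1 * (A * a i + B * v i)]
grows by at most [s n.+1 * G n] at step [n]: the sum carries the delayed terms
until they are absorbed by the dissipation, [s (n + N).+1] being [expR (lam N D)]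
times [s n.+1]. *)
Lemma discrete_halanay (R : realType) (N : nat) (D lam A A' B B' : R)
    (a v G : nat -> R) :
  0 <= D -> 0 <= A -> 0 <= B ->
  A * expR (lam * (N%:R * D)) + lam <= A' -> B * expR (lam * (N%:R * D)) <= B' ->
  (forall i, 0 <= a i) -> (forall i, 0 <= v i) ->
  (forall i, a (i + N).+1 <= a (i + N)%N +
     D * (- A' * a (i + N)%N + A * a i - B' * v (i + N)%N + B * v i) + G i) ->
  forall n,
  expR (lam * (n%:R * D)) * a (n + N)%N <=
  a N + D * (\sum_(0 <= i < N) expR (lam * (i.+1%:R * D)) * (A * a i + B * v i))
  + \sum_(0 <= i < n) expR (lam * (i.+1%:R * D)) * G i.
Proof.
move=> D0 A0 B0 AA BB a0 v0 step n.
pose s k := expR (lam * (k%:R * D)).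
pose S k := s k * a (k + N)%N +
  D * \sum_(k <= i < k + N) s i.+1 * (A * a i + B * v i).
suff : S n <= S 0%N + \sum_(0 <= i < n) s i.+1 * G i.
  rewrite {2}/S !add0n /s mul0r mulr0 expR0 mul1r; apply: le_trans.
  rewrite lerDl mulr_ge0// sumr_ge0// => i _.
  by rewrite mulr_ge0 ?expR_ge0// addr_ge0// mulr_ge0.
elim: n => [|n IH]; first by rewrite big_geq// addr0.
rewrite big_nat_recr//= addrA; apply: le_trans (lerD IH (lexx _)).
have sN : s (n + N).+1 = s n.+1 * expR (lam * (N%:R * D)).
  by rewrite /s -expRD -addSn natrD; congr expR; ring.
(* [1 - lam D <= expR (- lam D)] *)
have sn : s n.+1 * (1 - lam * D) <= s n.
  have -> : s n = s n.+1 * expR (- (lam * D)).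
    by rewrite /s -expRD -natr1; congr expR; ring.
  by rewrite ler_wpM2l ?expR_ge0// (le_trans _ (expR_ge1Dx _)).
have sum1 : \sum_(n.+1 <= i < n.+1 + N) s i.+1 * (A * a i + B * v i) +
    s n.+1 * (A * a n + B * v n) =
    \sum_(n <= i < n + N) s i.+1 * (A * a i + B * v i) +
    s (n + N).+1 * (A * a (n + N)%N + B * v (n + N)%N).
  rewrite addSn addrC -big_nat_recr ?leq_addr//=.
  by rewrite [RHS]big_ltn// ltnS leq_addr.
rewrite /S; move: sum1; rewrite addSn.
set S1 := \sum_(n.+1 <= i < _) _; set S0 := \sum_(n <= i < _) _ => sum1.
have -> : S1 = S0 + s (n + N).+1 * (A * a (n + N)%N + B * v (n + N)%N)
  - s n.+1 * (A * a n + B * v n) by rewrite -sum1 addrK.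
rewrite sN; set E := expR _ in AA BB *.
have s1 : 0 <= s n.+1 by exact: expR_ge0.
have h1 := ler_wpM2l s1 (step n).
have h2 := ler_wpM2r (a0 (n + N)%N) sn.
have h3 : 0 <= s n.+1 * D * (A' - (A * E + lam)) * a (n + N)%N.
  by rewrite !mulr_ge0// subr_ge0.
have h4 : 0 <= s n.+1 * D * (B' - B * E) * v (n + N)%N.
  by rewrite !mulr_ge0// subr_ge0.
rewrite /s in h1 h2 h3 h4 *.
move: h1 h2 h3 h4; set x := expR (lam * (n.+1%:R * D)).
set y := expR _; lra.
Qed.

(** * Brownian increments and the past *)

(** The filtration consists of families of sets and not of measurable types; the
generated measurable type makes the calculus of measurable functions available
at each time. *)
Definition measurable_wrt d (Omega : measurableType d) (R : realType)
    (G : set_system Omega) (X : Omega -> R) : Prop :=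
  measurable_fun setT (X : g_sigma_algebraType G -> R).

Section brownian_increments.
Context (R : realType) (dO : measure_display) (Omega : measurableType dO)
  (P : probability Omega R) (F : R -> set_system Omega) (m : nat)
  (W : R -> Omega -> 'cV[R]_m).
Hypotheses (hF : filtered_space_usual P F) (hW : brownian_motion P F W).

Lemma measurable_wrtP t (X : Omega -> R) : 0 <= t ->
  measurable_wrt (F t) X <->
  forall A : set R, measurable A -> F t (X @^-1` A).
Proof.
move=> t0; have sF := filtered_sigma hF t0.
split=> [mX A mA|FX _ A mA].
  by have := mX measurableT A mA; rewrite setTI measurable_g_measurableTypeE.
by rewrite setTI measurable_g_measurableTypeE//; exact: FX.
Qed.

Lemma measurable_wrt_mono s t (X : Omega -> R) : 0 <= s -> s <= t ->
  measurable_wrt (F s) X -> measurable_wrt (F t) X.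
Proof.
move=> s0 st /(measurable_wrtP _ s0) FX.
apply/(measurable_wrtP _ (le_trans s0 st)) => A mA.
by apply: (filtered_mono hF s0 st); exact: FX.
Qed.

Lemma measurable_wrt_measurable t (X : Omega -> R) : 0 <= t ->
  measurable_wrt (F t) X -> measurable_fun setT X.
Proof.
move=> t0 /(measurable_wrtP _ t0) FX _ A mA; rewrite setTI.
exact: (filtered_sub hF t0 (FX _ mA)).
Qed.

Lemma measurable_wrt_brownian t j : 0 <= t ->
  measurable_wrt (F t) (fun w => W t w j 0).
Proof.
move=> t0; apply/(measurable_wrtP _ t0) => A mA.
apply: (brownian_adapted hW t0 (B := (fun z : 'cV[R]_m => z j 0) @^-1` A)).
apply: continuous_preimage_borel mA; exact: coord_continuous.
Qed.

Variables (s t : R).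
Hypotheses (s0 : 0 <= s) (st : s < t).
Let t0 : 0 <= t. Proof. exact: le_trans s0 (ltW st). Qed.
Let Z (w : Omega) : 'cV[R]_m := W t w - W s w.
Let N := @normal_prob R 0 (Num.sqrt (t - s)).
Let sq0 : 0 < Num.sqrt (t - s). Proof. by rewrite sqrtr_gt0 subr_gt0. Qed.

Lemma measurable_brownian_increment j : measurable_fun setT (fun w => Z w j 0).
Proof.
have -> : (fun w => Z w j 0) = (fun w => W t w j 0 - W s w j 0).
  by apply/funext => w; rewrite !mxE.
apply: measurable_funB.
  exact: (measurable_wrt_measurable t0 (measurable_wrt_brownian _ t0)).
exact: (measurable_wrt_measurable s0 (measurable_wrt_brownian _ s0)).
Qed.

Let lawZ (B : 'I_m -> set R) : (forall j, measurable (B j)) ->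
  P [set w | forall j, B j (Z w j 0)] = (\prod_(j < m) N (B j))%E.
Proof.
move=> mB; rewrite -(brownian_normal hW s0 st mB); congr (P _).
by apply/seteqP; split=> w /= h j; have := h j; rewrite !mxE.
Qed.

(** A coordinate is read off from the law on rectangles by leaving all the other
sides unrestricted. *)
Lemma brownian_increment_law j (B : set R) : measurable B ->
  P ((fun w => Z w j 0) @^-1` B) = N B.
Proof.
move=> mB; pose B' (i : 'I_m) := if i == j then B else setT.
have mB' i : measurable (B' i) by rewrite /B'; case: ifP.
transitivity (P [set w | forall i, B' i (Z w i 0)]).
  congr (P _); apply/seteqP; split=> w /=.
    by move=> Bw i; rewrite /B'; case: eqP => // ->.
  by move=> /(_ j); rewrite /B' eqxx.
rewrite lawZ// (bigD1 j)//= {1}/B' eqxx big1 ?mule1// => i ij.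
by rewrite /B' (negbTE ij) /N probability_setT.
Qed.

Lemma brownian_increment_indep j l (A B : set R) : j != l ->
  measurable A -> measurable B ->
  P ((fun w => Z w j 0) @^-1` A `&` (fun w => Z w l 0) @^-1` B) =
  (P ((fun w => Z w j 0%R) @^-1` A) * P ((fun w => Z w l 0%R) @^-1` B))%E.
Proof.
move=> jl mA mB.
pose B' (i : 'I_m) := if i == j then A else if i == l then B else setT.
have mB' i : measurable (B' i) by rewrite /B'; case: ifP => //; case: ifP.
have B'j : B' j = A by rewrite /B' eqxx.
have B'l : B' l = B by rewrite /B' eq_sym (negbTE jl) eqxx.
transitivity (P [set w | forall i, B' i (Z w i 0)]).
  congr (P _); apply/seteqP; split=> w /=.
    move=> [Aw Bw] i; rewrite /B'; case: eqP => [->//|_].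
    by case: eqP => [->//|_].
  by move=> h; split; [have := h j; rewrite B'j|have := h l; rewrite B'l].
rewrite lawZ// !brownian_increment_law// (bigD1 j)//= (bigD1 l) 1?eq_sym//=.
rewrite B'j B'l big1 ?mule1// => i /andP[ij il].
by rewrite /B' (negbTE ij) (negbTE il) /N probability_setT.
Qed.

Lemma has_mean_brownian_increment j : has_mean P (fun w => Z w j 0) 0.
Proof.
exact: (@has_mean_law _ Omega R P _ _ N _ (@measurable_brownian_increment j)
  (@brownian_increment_law j) id 0 (has_mean_normal_id sq0)).
Qed.

Lemma has_mean_brownian_increment_cov j l :
  has_mean P (fun w => Z w j 0 * Z w l 0) ((t - s) * (j == l)%:R).
Proof.
have [<-|jl] := eqVneq j l.
  rewrite mulr1 -[t - s]sqr_sqrtr ?subr_ge0 ?(ltW st)//.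
  exact: (@has_mean_law _ Omega R P _ _ N _ (@measurable_brownian_increment j)
    (@brownian_increment_law j) _ _ (has_mean_normal_sqr sq0)).
rewrite mulr0 -[X in has_mean _ _ X](mulr0 0); apply: has_mean_indepM.
- by move=> A B; exact: brownian_increment_indep.
- exact: has_mean_brownian_increment.
- exact: has_mean_brownian_increment.
Qed.

(** The martingale property in the form used here: a bounded coefficient known at
time [s] does not see the increment after [s]. *)
Lemma has_mean_mul_increment (X : Omega -> R) M (phi : 'cV[R]_m -> R) :
  measurable_wrt (F s) X -> (forall w, `|X w| <= M) -> continuous phi ->
  has_mean P (phi \o Z) 0 -> has_mean P (fun w => X w * phi (Z w)) 0.
Proof.
move=> mX XM cphi Z0.
have [a Xa] := has_mean_bounded P (measurable_wrt_measurable s0 mX) XM.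
rewrite -[X in has_mean _ _ X](mulr0 a); apply: has_mean_indepM => // A B mA mB.
have FA : F s (X @^-1` A) by move/(measurable_wrtP _ s0): mX; exact.
have bB := continuous_preimage_borel cphi mB.
exact: (brownian_indep hW s0 st FA bB).
Qed.

Lemma has_mean_em_noise d (b : Omega -> 'cV[R]_d) (g : Omega -> 'M[R]_(d, m)) M :
  (forall k, measurable_wrt (F s) (fun w => b w k 0)) ->
  (forall k j, measurable_wrt (F s) (fun w => g w k j)) ->
  (forall w k, `|b w k 0| <= M) -> (forall w k j, `|g w k j| <= M) ->
  has_mean P (fun w => em_noise (t - s) (b w) (g w) (Z w)) 0.
Proof.
move=> mb mg bM gM.
have sum0 n (Y : 'I_n -> Omega -> R) : (forall i, has_mean P (Y i) 0) ->
    has_mean P (fun w => \sum_(i < n) Y i w) 0.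
  by move=> /(has_mean_sum (index_enum _)); rewrite big1_eq.
have coord j : continuous (fun z : 'cV[R]_m => z j 0) by exact: coord_continuous.
apply: (sum0 _ _) => k; rewrite -[X in has_mean _ _ X](addr0 0).
apply: has_meanD; apply: (sum0 _ _) => j.
  apply: (sum0 _ _) => l.
  pose phi (z : 'cV[R]_m) := z j 0 * z l 0 - (t - s) * (j == l)%:R.
  apply: (@has_mean_mul_increment _ (M * M) phi).
  - by apply: measurable_funM; exact: mg.
  - by move=> w; rewrite normrM ler_pM.
  - move=> z; have cM := continuousM (coord j z) (coord l z).
    have cB := continuousB cM (@cst_continuous _ _ ((t - s) * (j == l)%:R) _).
    exact: cB.
  - rewrite -[X in has_mean _ _ X](subrr ((t - s) * (j == l)%:R)).
    apply: has_meanD.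
      exact: has_mean_brownian_increment_cov.
    exact: has_mean_cst.
apply: (@has_mean_mul_increment _ (2 * M * M) (fun z => z j 0)).
- apply: measurable_funM; last exact: mg.
  by apply: measurable_funM; [exact: measurable_cst|exact: mb].
- by move=> w; rewrite !normrM ger0_norm// ler_pM ?mulr_ge0// ler_pM.
- exact: coord.
- exact: has_mean_brownian_increment.
Qed.

End brownian_increments.

(** * Growth of the coefficients, and the initial segment *)

Section coefficients.
Context (R : realType) (d m : nat).
Context (f : 'cV[R]_d -> 'cV[R]_d -> 'cV[R]_d)
  (g : 'cV[R]_d -> 'cV[R]_d -> 'M[R]_(d, m)) (Phi Phiinv : R -> R).

(** The quotients that define the growth ratio have a positive denominator off the
origin, and the denominator is at most [|x| + |y|]; at the origin both sides
vanish. *)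
Lemma growth_control_bound l (x y : 'cV[R]_d) : f 0 0 = 0 -> g 0 0 = 0 ->
  growth_control f g Phi Phiinv -> 1 <= l -> enorm x <= l -> enorm y <= l ->
  enorm (f x y) <= Phi l * (enorm x + enorm y) /\
  enorm (g x y) ^+ 2 <= Phi l * (enorm x + enorm y) ^+ 2.
Proof.
have min0 (u v : R) : 0 <= u -> 0 <= v -> u + Num.min 1 v = 0 -> u = 0 /\ v = 0.
  by move=> u0 v0; case: leP => *; lra.
move=> f0 g0 gc l1 xl yl; have P0 := Phi_ge0 gc l1.
have e0 p q : enorm (0 : 'M[R]_(p, q)) = 0 by rewrite -(scale0r 0) enormZ normr0 mul0r.
have xy0 : 0 <= enorm x + enorm y by rewrite addr_ge0 ?enorm_ge0.
have [xy|xy] := pselect ((x, y) = (0, 0)).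
  by case: xy => -> ->; rewrite f0 g0 !e0 addr0 expr0n/= !mulr0.
pose den := enorm x + Num.min 1 (enorm y).
have den0 : 0 < den.
  rewrite lt_neqAle eq_sym addr_ge0 ?le_min ?enorm_ge0 ?ler01// andbT.
  apply/eqP => /(min0 _ _ (enorm_ge0 _) (enorm_ge0 _))[x0 y0].
  by apply: xy; rewrite (enorm_eq0 x0) (enorm_eq0 y0).
have denle : den <= enorm x + enorm y by rewrite lerD2l ge_min lexx orbT.
have : growth_ratio f g x y <= Phi l.
  rewrite -lee_fin; apply: le_trans (Phi_bound gc l1).
  by apply: ereal_sup_ubound; exists (x, y) => //; split => //=; rewrite ge_max xl.
rewrite /growth_ratio -/den ge_max !ler_pdivrMr ?exprn_gt0// => /andP[fl gl].
split; first by apply: le_trans fl _; rewrite ler_wpM2l.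
by apply: le_trans gl _; rewrite ler_wpM2l// lerXn2r// nnegrE// ltW.
Qed.

(** As [D ^ (- mu) >= 1], the level [h] is at least [Phi K], hence lies in the range
where [Phiinv] inverts [Phi], and monotonicity places the radius beyond [K]. *)
Lemma truncation_radius K D mu : growth_control f g Phi Phiinv -> 1 <= K ->
  0 < D <= 1 -> 0 <= mu -> let h := Phi K * D `^ (- mu) in
  [/\ 0 <= h, K <= Phiinv h & Phi (Phiinv h) = h].
Proof.
move=> gc K1 /andP[D0 D1] mu0 h.
have PK := Phi_ge0 gc K1.
have Dmu : 1 <= D `^ (- mu) by rewrite -[leLHS](powRr0 D) ger_powR ?D0// oppr_le0.
have Kh : Phi K <= h by rewrite /h ler_peMr.
have P1h : h \in `[Phi 1, +oo[.
  rewrite in_itv/= andbT (le_trans _ Kh)// le_eqVlt.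
  move: K1; rewrite le_eqVlt => /predU1P[<-|K1]; first by rewrite eqxx.
  apply/orP; right; apply: (Phi_incr gc) => //; rewrite in_itv/= andbT ?lexx//.
  exact: ltW.
have Pr := PhiinvK gc P1h.
split=> //; first exact: le_trans PK Kh.
rewrite leNgt; apply/negP => rK.
have : Phi (Phiinv h) < Phi K.
  by apply: (Phi_incr gc) => //; rewrite in_itv/= andbT// (Phiinv_ge1 gc).
by rewrite Pr ltNge Kh.
Qed.

End coefficients.

Lemma continuous_bounded_on_path (R : realType) (V : topologicalType)
    (tau : R) (xi : R -> V) (phi : V -> R) : 0 <= tau ->
  {within `[- tau, 0], continuous xi} -> continuous phi ->
  exists2 Q, 0 <= Q & forall t, - tau <= t <= 0 -> phi (xi t) <= Q.
Proof.
move=> tau0 cxi cphi.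
have [|||c _ cP] := @compact_EVT_max _ R (phi \o xi) `[- tau, 0]%classic.
- by exists 0; rewrite /= in_itv/= lexx oppr_le0 tau0.
- exact: segment_compact.
- move=> x; apply: (@continuous_comp (subspace `[- tau, 0]%classic) V R).
    exact: cxi.
  exact: cphi.
exists (Num.max 0 (phi (xi c))); first by rewrite le_max lexx.
by move=> t tI; rewrite le_max cP ?orbT// inE/= in_itv.
Qed.

Lemma enorm_path_bounded (R : realType) d (tau : R) (xi : R -> 'cV[R]_d) :
  0 <= tau -> {within `[- tau, 0], continuous xi} ->
  exists Q, forall t, - tau <= t <= 0 -> enorm (xi t) <= Q.
Proof.
move=> tau0 cxi.
have /choice[Q QP] i : exists Q, forall t, - tau <= t <= 0 -> (xi t i 0) ^+ 2 <= Q.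
  have [|Q _ QP] := @continuous_bounded_on_path R _ tau xi
      (fun x => x i 0 ^+ 2) tau0 cxi; last by exists Q.
  move=> x; have cx := @coord_continuous R d 1 i 0 x.
  exact: (continuousM cx cx).
exists (1 + \sum_(i < d) Q i) => t tI.
have : enorm (xi t) ^+ 2 <= \sum_(i < d) Q i.
  by rewrite sqr_enorm_cV ler_sum// => i _; exact: QP.
by have := sqr_ge0 (enorm (xi t) - 1); nra.
Qed.

Lemma enorm_le_init_norm (R : realType) d (tau : R) (xi : R -> 'cV[R]_d) t :
  0 <= tau -> {within `[- tau, 0], continuous xi} -> - tau <= t <= 0 ->
  enorm (xi t) <= init_norm tau xi.
Proof.
move=> tau0 cxi tI; have [Q QP] := enorm_path_bounded tau0 cxi.
apply: ub_le_sup; last by exists t => //=; rewrite in_itv.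
by exists Q => _ [s /=] /[!in_itv]/= /QP sQ <-.
Qed.

(** * The truncated scheme *)

Section scheme.
Context (R : realType) (d m : nat).
Context (dO : measure_display) (Omega : measurableType dO)
  (P : probability Omega R) (F : R -> set_system Omega)
  (hF : filtered_space_usual P F)
  (W : R -> Omega -> 'cV[R]_m) (hW : brownian_motion P F W).
Context (tau : R) (tau0 : 0 < tau).
Context (f : 'cV[R]_d -> 'cV[R]_d -> 'cV[R]_d)
  (g : 'cV[R]_d -> 'cV[R]_d -> 'M[R]_(d, m)).
Context (hf : borel_fun (fun p : 'cV[R]_d * 'cV[R]_d => f p.1 p.2))
  (hg : borel_fun (fun p : 'cV[R]_d * 'cV[R]_d => g p.1 p.2))
  (hf0 : f 0 0 = 0) (hg0 : g 0 0 = 0).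
Context (xi : R -> 'cV[R]_d) (hxi : {within `[- tau, 0], continuous xi}).
Context (Phi Phiinv : R -> R) (hPhi : growth_control f g Phi Phiinv).
Context (mu : R) (mu0 : 0 < mu).
Context (N : nat) (N0 : (0 < N)%N) (D : R) (DE : D = tau / N%:R) (D1 : D <= 1).
Context (y : int -> Omega -> 'cV[R]_d)
  (hy : truncated_EM f g tau xi Phi Phiinv mu W N D y).

Let h := step_bound Phi tau xi mu D.
Let r := Phiinv h.

(** Starting the indices at the beginning of the initial segment makes the scheme a
sequence on [nat], the form in which [discrete_halanay] treats delays. *)
Definition shifted_scheme (k : nat) (w : Omega) : 'cV[R]_d := y (k%:Z - N%:Z) w.
Local Notation Y := shifted_scheme.

Let D0 : 0 < D. Proof. by rewrite DE divr_gt0// ltr0n. Qed.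
Let ND : N%:R * D = tau.
Proof. by rewrite DE mulrCA divff ?mulr1// pnatr_eq0 -lt0n. Qed.

Let rP : [/\ 0 <= h, Num.max (init_norm tau xi) 1 <= r & Phi r = h].
Proof.
apply: truncation_radius hPhi _ _ (ltW mu0); first by rewrite le_max lexx orbT.
by rewrite D0.
Qed.
Let h0 : 0 <= h. Proof. by case: rP. Qed.
Let r1 : 1 <= r. Proof. by case: rP => _ + _; rewrite ge_max => /andP[]. Qed.
Let r0 : 0 <= r. Proof. exact: le_trans ler01 r1. Qed.

Lemma shifted_scheme_init k w : (k <= N)%N ->
  exists2 t, - tau <= t <= 0 & Y k w = xi t.
Proof.
move=> kN; exists ((k%:Z - N%:Z)%:~R * D); last first.
  by rewrite /shifted_scheme (EM_init hy)// lerBrDl subrr lez_nat subr_le0 lez_nat kN.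
rewrite intrB mulrBl ND lerBrDl subrr lerBlDl addr0.
by rewrite mulr_ge0 ?(ltW D0)//= -ND ler_wpM2r ?(ltW D0)// ler_nat.
Qed.

Definition increment (i : nat) (w : Omega) : 'cV[R]_m :=
  W (i.+1%:R * D) w - W (i%:R * D) w.

Lemma shifted_scheme_step i w : Y (i + N).+1 w =
  truncation r (Y (i + N) w + D *: f (Y (i + N) w) (Y i w)
    + g (Y (i + N) w) (Y i w) *m increment i w).
Proof.
have e : (i + N)%N%:Z - N%:Z = i%:Z by rewrite PoszD addrK.
have e1 : (i + N).+1%:Z - N%:Z = i%:Z + 1.
  by rewrite -addn1 !PoszD addrAC addrK.
by rewrite /shifted_scheme e1 e (EM_step hy).
Qed.

(** The initial segment lies in the truncation ball because the radius is at least
[init_norm tau xi]; every later value has been truncated. *)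
Lemma shifted_scheme_bounded k w : enorm (Y k w) <= r.
Proof.
have [kN|] := leqP k N.
  have [t tI ->] := shifted_scheme_init w kN.
  have := enorm_le_init_norm (ltW tau0) hxi tI; move/le_trans; apply.
  by case: rP => _ + _; rewrite ge_max => /andP[].
case: k => // k; rewrite ltnS => Nk; rewrite -(subnK Nk) shifted_scheme_step.
by rewrite enorm_truncation// ge_min lexx orbT.
Qed.

Lemma shifted_scheme_f i w : enorm (f (Y (i + N) w) (Y i w)) <=
  h * (enorm (Y (i + N) w) + enorm (Y i w)).
Proof.
case: rP => _ _ <-; have := growth_control_bound hf0 hg0 hPhi r1
  (shifted_scheme_bounded (i + N) w) (shifted_scheme_bounded i w).
by case.
Qed.

Lemma shifted_scheme_g i w : enorm (g (Y (i + N) w) (Y i w)) ^+ 2 <=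
  h * (enorm (Y (i + N) w) + enorm (Y i w)) ^+ 2.
Proof.
case: rP => _ _ <-; have := growth_control_bound hf0 hg0 hPhi r1
  (shifted_scheme_bounded (i + N) w) (shifted_scheme_bounded i w).
by case.
Qed.

Let tD_ge0 i : 0 <= i%:R * D. Proof. by rewrite mulr_ge0// ltW. Qed.
Let tD_lt i : i%:R * D < i.+1%:R * D. Proof. by rewrite ltr_pM2r// ltr_nat. Qed.

(** With shifted indices, [Y (i + N)] is the value at time [i * D], so that at
this time exactly the indices up to [i + N] are known. *)
Lemma shifted_scheme_adapted i k j : (k <= i + N)%N ->
  measurable_wrt (F (i%:R * D)) (fun w => Y k w j 0).
Proof.
elim: i k j => [|i IH] k j kiN.
  pose t := (k%:Z - N%:Z)%:~R * D.
  have -> : (fun w => Y k w j 0) = cst (xi t j 0).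
    apply/funext => w; rewrite /shifted_scheme (EM_init hy)//.
    by rewrite lerBrDl subrr lez_nat subr_le0 lez_nat kiN.
  exact: measurable_cst.
move: kiN; rewrite leq_eqVlt => /predU1P[->|]; last first.
  rewrite addSn ltnS => kiN.
  exact: (measurable_wrt_mono hF (tD_ge0 i) (ltW (tD_lt i)) (IH _ _ kiN)).
have mY k' j' : (k' <= i + N)%N ->
    measurable_wrt (F (i.+1%:R * D)) (fun w => Y k' w j' 0).
  by move=> k'N; exact: (measurable_wrt_mono hF (tD_ge0 i) (ltW (tD_lt i)) (IH _ _ k'N)).
have mW j' : measurable_wrt (F (i.+1%:R * D)) (fun w => increment i w j' 0).
  have -> : (fun w => increment i w j' 0) =
      (fun w => W (i.+1%:R * D) w j' 0 - W (i%:R * D) w j' 0).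
    by apply/funext => w; rewrite !mxE.
  apply: measurable_funB.
    exact: (measurable_wrt_brownian hF hW).
  apply: (measurable_wrt_mono hF (tD_ge0 i) (ltW (tD_lt i))).
  exact: (measurable_wrt_brownian hF hW).
rewrite addSn; under eq_fun do rewrite shifted_scheme_step.
apply: measurable_truncation => {}j.
under eq_fun do rewrite !mxE.
apply: measurable_funD.
  apply: measurable_funD; first exact: mY.
  apply: measurable_funM; first exact: measurable_cst.
  by apply: (borel_fun_measurable hf) => j'; apply: mY; rewrite ?leq_addr.
apply: measurable_sum => l; apply: measurable_funM; last exact: mW.
by apply: (borel_fun_measurable hg) => j'; apply: mY; rewrite ?leq_addr.
Qed.

Definition scheme_noise (i : nat) (w : Omega) : R :=
  em_noise D (Y (i + N) w + D *: f (Y (i + N) w) (Y i w))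
    (g (Y (i + N) w) (Y i w)) (increment i w).

Lemma has_mean_scheme_noise i : has_mean P (scheme_noise i) 0.
Proof.
have DE' : i.+1%:R * D - i%:R * D = D by rewrite -mulrBl -natrB// subSnn mul1r.
(* The two summands of [M] bound [|a + D f|] and [|g|], the latter because
   [x <= 1 + x ^+ 2]. *)
pose M := r + D * (h * (r + r)) + (1 + h * (r + r) ^+ 2).
have M1 : 0 <= r + D * (h * (r + r)).
  by rewrite addr_ge0// mulr_ge0 ?(ltW D0)// mulr_ge0// addr_ge0.
have M2 : 0 <= 1 + h * (r + r) ^+ 2 by rewrite addr_ge0// mulr_ge0// sqr_ge0.
have Yr k w : enorm (Y k w) <= r by exact: shifted_scheme_bounded.
have YY w : enorm (Y (i + N) w) + enorm (Y i w) <= r + r by exact: lerD.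
have YY0 w : 0 <= enorm (Y (i + N) w) + enorm (Y i w).
  by rewrite addr_ge0// enorm_ge0.
have mY k j : (k <= i + N)%N -> measurable_wrt (F (i%:R * D)) (fun w => Y k w j 0).
  exact: shifted_scheme_adapted.
rewrite /scheme_noise; under eq_fun do rewrite -{1}DE'.
apply: (has_mean_em_noise hF hW (tD_ge0 i) (tD_lt i) (M := M)).
- move=> k; under eq_fun do rewrite !mxE.
  apply: measurable_funD; first exact: mY.
  apply: measurable_funM; first exact: measurable_cst.
  by apply: (borel_fun_measurable hf) => j'; apply: mY; rewrite ?leq_addr.
- by move=> k j; apply: (borel_fun_measurable hg) => j'; apply: mY; rewrite ?leq_addr.
- move=> w k; rewrite !mxE; apply: le_trans (_ : r + D * (h * (r + r)) <= M).
    apply: le_trans (ler_normD _ _) _; rewrite lerD//.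
      exact: le_trans (ler_coord_enorm _ _ _) (Yr _ _).
    rewrite normrM (gtr0_norm D0) ler_wpM2l ?(ltW D0)//.
    apply: le_trans (ler_coord_enorm _ _ _) _.
    by apply: le_trans (shifted_scheme_f i w) _; rewrite ler_wpM2l.
  by rewrite lerDl.
- move=> w k j; apply: le_trans (_ : 1 + h * (r + r) ^+ 2 <= M); last by rewrite lerDr.
  apply: le_trans (ler_coord_enorm _ _ _) _.
  have : enorm (g (Y (i + N) w) (Y i w)) ^+ 2 <= h * (r + r) ^+ 2.
    apply: le_trans (shifted_scheme_g i w) _.
    by rewrite ler_wpM2l// lerXn2r// nnegrE// addr_ge0.
  have := sqr_ge0 (enorm (g (Y (i + N) w) (Y i w)) - 1).
  by move: (enorm _) (h * _) => u v; nra.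
Qed.

(** One step of the dissipativity estimate. The truncation is a contraction
towards the origin, and the growth control turns the term [D ^+ 2 * |f|^2] of
the Euler step into a perturbation of relative size [2 D h^2]. *)
Lemma scheme_dissipation K6' K6 K7' K7 (V2 : 'cV[R]_d -> R) eta i w :
  delay_dissipative f g K6' K6 K7' K7 V2 -> 2 * D * h ^+ 2 <= eta ->
  enorm (Y (i + N).+1 w) ^+ 2 <= enorm (Y (i + N) w) ^+ 2 +
    D * (- (K6' - eta) * enorm (Y (i + N) w) ^+ 2
         + (K6 + eta) * enorm (Y i w) ^+ 2
         - K7' * V2 (Y (i + N) w) + K7 * V2 (Y i w)) + scheme_noise i w.
Proof.
move=> H7 heta; rewrite shifted_scheme_step enorm_truncation//.
have := sqr_enorm_em_step D (Y (i + N) w) (f (Y (i + N) w) (Y i w))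
  (g (Y (i + N) w) (Y i w)) (increment i w).
set v := _ + _ *m _ => vE.
have : Num.min (enorm v) r ^+ 2 <= enorm v ^+ 2.
  by rewrite lerXn2r// ?nnegrE ?le_min ?enorm_ge0// ge_min lexx.
move=> /le_trans; apply; rewrite vE -/(scheme_noise i w) lerD2r -addrA lerD2l.
have := diss_ineq H7 (Y (i + N) w) (Y i w).
have := shifted_scheme_f i w.
move: (dotp _ _ + _) (enorm_ge0 (f (Y (i + N) w) (Y i w))).
move: (enorm (f _ _)) (enorm_ge0 (Y (i + N) w)) (enorm_ge0 (Y i w)).
move: (V2 (Y (i + N) w)) (V2 (Y i w)) => va vb.
move: (enorm (Y (i + N) w)) (enorm (Y i w)).
move=> a b fn a0 b0 q fn0 fle qle.
have f2 : fn ^+ 2 <= h ^+ 2 * (2 * (a ^+ 2 + b ^+ 2)).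
  apply: (@le_trans _ _ ((h * (a + b)) ^+ 2)).
    by rewrite lerXn2r ?nnegrE// mulr_ge0// addr_ge0.
  by rewrite exprMn ler_wpM2l ?sqr_ge0//; have := sqr_ge0 (a - b); nra.
have Df : D * fn ^+ 2 <= eta * (a ^+ 2 + b ^+ 2).
  have := ler_wpM2l (ltW D0) f2; move/le_trans; apply.
  rewrite [leLHS](_ : _ = 2 * D * h ^+ 2 * (a ^+ 2 + b ^+ 2)); last by ring.
  by rewrite ler_wpM2r// addr_ge0// sqr_ge0.
rewrite expr2 -mulrA -mulrDr ler_wpM2l ?(ltW D0)//.
by lra.
Qed.

End scheme.

(** * The theorem *)

Theorem theorem3p6 (R : realType) (d m : nat)
  (dO : measure_display) (Omega : measurableType dO) (P : probability Omega R)
  (F : R -> set_system Omega) (hF : filtered_space_usual P F)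
  (W : R -> Omega -> 'cV[R]_m) (hW : brownian_motion P F W)
  (tau : R) (htau : 0 < tau)
  (f : 'cV[R]_d -> 'cV[R]_d -> 'cV[R]_d)
  (g : 'cV[R]_d -> 'cV[R]_d -> 'M[R]_(d, m))
  (hf : borel_fun (fun p : 'cV[R]_d * 'cV[R]_d => f p.1 p.2))
  (hg : borel_fun (fun p : 'cV[R]_d * 'cV[R]_d => g p.1 p.2))
  (hf0 : f 0 0 = 0) (hg0 : g 0 0 = 0)
  (xi : R -> 'cV[R]_d) (hxi : {within `[- tau, 0], continuous xi})
  (Phi Phiinv : R -> R) (hPhi : growth_control f g Phi Phiinv)
  (mu : R) (hmu : 0 < mu < 2^-1)
  (H1 : locally_lipschitz_fst f g)
  (K6' K6 K7' K7 : R) (V2 : 'cV[R]_d -> R)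
  (H7 : delay_dissipative f g K6' K6 K7' K7 V2)
  (H8 : linear_at_zero_fst f g)
  (gamma : R) (hgamma : 0 < gamma)
  (hgamma6 : K6 * expR (gamma * tau) + gamma <= K6')
  (hgamma7 : K7 * expR (gamma * tau) <= K7') :
  forall eps : R, 0 < eps < gamma ->
  exists Dbar C : R, [/\ 0 < Dbar <= 1, 0 < C &
    forall (N : nat) (D : R), (0 < N)%N -> D = tau / N%:R -> D <= Dbar ->
    forall y : int -> Omega -> 'cV[R]_d,
    truncated_EM f g tau xi Phi Phiinv mu W N D y ->
    forall i : nat,
      ('E_P[(fun w => enorm (y i%:Z w) ^+ 2)%R]
        <= (C * expR (- (gamma - eps) * (i%:R * D)))%:E)%E].
move=> eps /andP[eps0 epsg].
have [K6_0 _ K7_0 _ V2_0 V2_c _] := H7.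
have /andP[mu0 mu12] := hmu.
pose lam := gamma - eps; have lam0 : 0 < lam by rewrite subr_gt0.
have e1 : 0 < expR (gamma * tau) by exact: expR_gt0.
(* [eta] is the loss allowed in [K6'] and [K6]: at most
   [eta * (1 + expR (lam * tau))] is spent, and [eps] is available. *)
pose eta := eps / (1 + expR (gamma * tau)).
have eta0 : 0 < eta by rewrite divr_gt0// addr_gt0.
have etaE : eta * (1 + expR (gamma * tau)) = eps by rewrite divfK// gt_eqF// addr_gt0.
have lamg : expR (lam * tau) <= expR (gamma * tau).
  by rewrite ler_expR ler_wpM2r// ?ltW// /lam; lra.
pose K := Phi (Num.max (init_norm tau xi) 1).
have K_0 : 0 <= K by apply: (Phi_ge0 hPhi); rewrite le_max lexx orbT.
pose p := 1 - 2 * mu; have p0 : 0 < p by rewrite /p; lra.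
(* [q] bounds [D ^ (1 - 2 mu)] so that [2 K^2 D ^ (1 - 2 mu) <= eta]. *)
pose q := eta / (2 * K ^+ 2 + 1).
have q0 : 0 < q by rewrite divr_gt0// ltr_wpDl// mulr_ge0// sqr_ge0.
have [Q2 Q2_0 V2Q] := continuous_bounded_on_path (ltW htau) hxi V2_c.
pose Q1 := init_norm tau xi.
pose C := Q1 ^+ 2 + tau * (expR (lam * tau) * ((K6 + eta) * Q1 ^+ 2 + K7 * Q2)) + 1.
(* The summand 1 in [C] keeps the constant positive when the initial segment
   and [V2] vanish. *)
exists (Num.min 1 (q `^ p^-1)), C; split.
- by rewrite lt_min ltr01 powR_gt0//= ge_min lexx.
- rewrite ltr_wpDl// addr_ge0 ?sqr_ge0// mulr_ge0 ?(ltW htau)//.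
  by rewrite mulr_ge0 ?expR_ge0// addr_ge0// mulr_ge0 ?sqr_ge0// addr_ge0// ltW.
move=> N D N0 DE; rewrite le_min => /andP[D1 Dq] y hy i.
have D0 : 0 < D by rewrite DE divr_gt0// ltr0n.
have ND : N%:R * D = tau by rewrite DE mulrCA divff ?mulr1// pnatr_eq0 -lt0n.
pose h := step_bound Phi tau xi mu D.
have heta : 2 * D * h ^+ 2 <= eta.
  have Dp : D `^ p <= q.
    have qp : (q `^ p^-1) `^ p = q.
      by rewrite -powRrM mulVf ?gt_eqF// powRr1// ltW.
    by rewrite -[leRHS]qp ge0_ler_powR ?nnegrE ?powR_ge0// ltW.
  have -> : 2 * D * h ^+ 2 = 2 * K ^+ 2 * D `^ p.
    rewrite /h /step_bound -/K exprMn.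
    rewrite -(@powR_mulrn _ (D `^ (- mu)) 2) ?powR_ge0// -powRrM.
    have -> : D `^ p = D * D `^ (- mu * 2).
      rewrite -[in X in _ = X * _](powRr1 (ltW D0)) -powRD.
        by congr (_ `^ _); rewrite /p; ring.
      by rewrite (gt_eqF D0) implybT.
    by ring.
  apply: (@le_trans _ _ (2 * K ^+ 2 * q)).
    by rewrite ler_wpM2l// mulr_ge0// sqr_ge0.
  rewrite /q mulrA ler_pdivrMr ?ltr_wpDl ?mulr_ge0 ?sqr_ge0//.
  by rewrite mulrC ler_wpM2l ?(ltW eta0)// lerDl.
pose Y := shifted_scheme N y.
have YE w : y i%:Z w = Y (i + N)%N w by rewrite /Y /shifted_scheme PoszD addrK.
pose E := expR (lam * (i%:R * D)).
pose S w := \sum_(0 <= k < i) expR (lam * (k.+1%:R * D)) *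
  scheme_noise W f g N D y k w.
have pathwise w : E * enorm (Y (i + N)%N w) ^+ 2 <= C + S w.
  pose a k := enorm (Y k w) ^+ 2; pose v k := V2 (Y k w).
  have := @discrete_halanay R N D lam (K6 + eta) (K6' - eta) K7 K7' a v
    (fun k => scheme_noise W f g N D y k w) (ltW D0).
  rewrite ND => /(_ _ K7_0 _ _ _ _ _ i) dh; apply: le_trans (dh _ _ _ _ _ _) _.
  - by rewrite addr_ge0// ltW.
  - have h1 : K6 * expR (lam * tau) <= K6 * expR (gamma * tau).
      by rewrite ler_wpM2l// ltW.
    have h2 : eta * expR (lam * tau) <= eta * expR (gamma * tau).
      by rewrite ler_wpM2l// ltW.
    rewrite /lam; move: h1 h2 etaE hgamma6; rewrite -/lam.
    by move: (expR _) (expR _) => x z; rewrite /lam; lra.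
  - by apply: le_trans hgamma7; rewrite ler_wpM2l.
  - by move=> k; exact: sqr_ge0.
  - by move=> k; exact: V2_0.
  - move=> k; exact: (scheme_dissipation htau hf0 hg0 hxi hPhi mu0 N0 DE D1 hy
      k w H7 heta).
  have aN k : (k <= N)%N -> a k <= Q1 ^+ 2 /\ v k <= Q2.
    move=> kN; have [t tI Yt] := shifted_scheme_init htau N0 DE hy w kN.
    have xQ : enorm (xi t) <= Q1 by exact: enorm_le_init_norm (ltW htau) hxi tI.
    rewrite /a /v /Y Yt; split; last exact: V2Q.
    by rewrite lerXn2r ?nnegrE ?enorm_ge0// (le_trans (enorm_ge0 _) xQ).
  rewrite lerD2r /C -[leLHS]addr0 lerD// lerD//; first by case: (aN N (leqnn N)).
  set B := (X in _ <= tau * X).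
  have -> : tau * B = D * (B *+ N) by rewrite -ND -mulr_natl; ring.
  rewrite ler_wpM2l ?(ltW D0)// -[N in B *+ N]subn0 -sumr_const_nat.
  apply: ler_sum_nat => k /andP[_ kN].
  have [aQ vQ] := aN k (ltnW kN).
  have K60 : 0 <= K6 + eta by rewrite addr_ge0// ltW.
  rewrite /B; apply: ler_pM; first exact: expR_ge0.
  - by rewrite addr_ge0// mulr_ge0 ?sqr_ge0 ?V2_0.
  - rewrite ler_expR ler_wpM2l ?(ltW lam0)// -ND ler_wpM2r ?(ltW D0)//.
    by rewrite ler_nat.
  - by rewrite lerD// ler_wpM2l.
have Sm : has_mean P (fun w => E^-1 * (C + S w)) (E^-1 * (C + 0)).
  apply: has_meanZ; apply: has_meanD; first exact: has_mean_cst.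
  rewrite [X in has_mean _ _ X](_ : _ =
    \sum_(0 <= k < i) expR (lam * (k.+1%:R * D)) * 0); last first.
    by rewrite big1// => k _; rewrite mulr0.
  apply: has_mean_sum => k; apply: has_meanZ.
  exact: (has_mean_scheme_noise hF hW htau hf hg hf0 hg0 hxi hPhi mu0 N0 DE D1 hy).
have <- : E^-1 * (C + 0) = C * expR (- (gamma - eps) * (i%:R * D)).
  by rewrite addr0 mulrC -expRN /E /lam mulNr.
apply: expectation_le_mean Sm.
- apply: measurable_funX; apply: measurable_enorm => k j; rewrite (ord1 j).
  under eq_fun do rewrite YE.
  apply: (measurable_wrt_measurable hF (t := i%:R * D)).
    by rewrite mulr_ge0// ltW.
  exact: (shifted_scheme_adapted hF hW htau hf hg N0 DE hy).
- by move=> w; exact: sqr_ge0.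
- by move=> w; rewrite YE ler_pdivlMl ?expR_gt0//; exact: pathwise.
Qed.
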